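(* Let $G$ and $H$ be nonempty finite simple graphs, and let $G_1=G\times K_1$, $H_1=H\times K_1$. Then $$\dim(G\times H)=\dim(G_1)+\dim(H_1).$$ More precisely, for every vertex $(x,y)$ of $G\times H$ (so $x$ is a vertex of $G_1$ and $y$ is a vertex of $H_1$), $$\dim(G\times H)(x,y)=\dim(G_1)(x)+\dim(H_1)(y).$$
   Context: Unit sphere: for a vertex $x$ of a graph $G$, $S_G(x)$ is the subgraph induced on the neighbors of $x$. Dimension (inductive, rational-valued): $\dim(\emptyset)=-1$, and for a nonempty finite simple graph $G$ with vertex set $V$, $\dim(G)=1+\frac1{|V|}\sum_{x\in V}\dim(S_G(x))$. The dimension at a vertex is $\dim(G)(x)=1+\dim(S_G(x))$, so $\dim(G)$ is the average of $\dim(G)(x)$ over the vertices. Product: for finite simple graphs $G,H$, the graph $G\times H$ has as vertices all pairs $(x,y)$ with $x$ a nonempty complete subgraph (simplex, identified with its vertex set) of $G$ and $y$ a nonempty complete subgraph of $H$. Two distinct vertices $(x,y)\neq(x',y')$ are adjacent iff ($x\subseteq x'$ and $y\subseteq y'$) or ($x'\subseteq x$ and $y'\subseteq y$). Since $K_1$ has a single simplex, the vertices of $G_1=G\times K_1$ are identified with the nonempty complete subgraphs of $G$, two being adjacent iff one properly contains the other; likewise for $H_1$. *)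

(* Defs.v *)
From mathcomp Require Import all_boot all_order all_algebra.

Set Implicit Arguments.
Unset Strict Implicit.
Unset Printing Implicit Defensive.

Import Num.Theory GRing.Theory.
Local Open Scope ring_scope.

(** Possibly empty finite simple graphs. *)
Record sgraph := SGraph {
  svertex :> finType;
  sedge : rel svertex;
  sedge_sym : symmetric sedge;
  sedge_irr : irreflexive sedge }.

Section Induced.
Variables (G : sgraph) (A : {set G}).

Definition induced_rel : rel {x : G | x \in A} :=
  fun u v => sedge (val u) (val v).

Fact induced_sym : symmetric induced_rel.
Proof. by move=> u v; apply: sedge_sym. Qed.

Fact induced_irr : irreflexive induced_rel.
Proof. by move=> u; apply: sedge_irr. Qed.

Definition induced : sgraph := SGraph induced_sym induced_irr.
End Induced.

Definition sphere (G : sgraph) (x : G) : sgraph :=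
  induced [set y | sedge x y].

(** The recursion is structural on a bound [n] on the number of vertices, which
    decreases strictly when passing to a sphere; the value [0] on exhausted
    fuel is never reached by [gdim].  The defining equation is [gdimE]. *)
Fixpoint gdim_fuel (n : nat) (G : sgraph) : rat :=
  if #|G| == 0%N then -1 else
  if n is n'.+1
  then 1 + (\sum_(x : G) gdim_fuel n' (sphere x)) / #|G|%:R
  else 0.

Definition gdim (G : sgraph) : rat := gdim_fuel #|G| G.

Definition gdim_at (G : sgraph) (x : G) : rat := 1 + gdim (sphere x).

Lemma card_sphere (G : sgraph) (x : G) : (#|sphere x| < #|G|)%N.
Proof.
rewrite card_sig; apply: (@leq_trans #|G|.-1.+1); last first.
  by rewrite prednK //; apply/card_gt0P; exists x.
rewrite ltnS -(cardC1 x); apply/subset_leq_card/subsetP => y.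
by rewrite !inE; apply: contraTneq => ->; rewrite sedge_irr.
Qed.

Lemma gdim_fuelE n (G : sgraph) : (#|G| <= n)%N -> gdim_fuel n G = gdim G.
Proof.
rewrite /gdim; have [m] := ubnP n.
elim: m n G => // m IHm [|n] G; first by rewrite leqn0 => _ /eqP ->.
rewrite ltnS => ltnm leGn; case EG: #|G| => [|k]; rewrite /= EG //=.
rewrite EG ltnS in leGn.
congr (_ + _ / _); apply: eq_bigr => x _.
have := card_sphere x; rewrite EG ltnS => lek.
have lekm := leq_ltn_trans leGn ltnm.
by rewrite (IHm n) ?(IHm k) // (leq_trans lek).
Qed.

Lemma gdimE (G : sgraph) :
  gdim G = if #|G| == 0%N then -1
          else 1 + (\sum_(x : G) gdim (sphere x)) / #|G|%:R.
Proof.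
rewrite {1}/gdim; case EG: #|G| => [|k]; rewrite /= EG //=.
congr (_ + _ / _); apply: eq_bigr => x _.
by apply: gdim_fuelE; have := card_sphere x; rewrite EG ltnS.
Qed.

Lemma gdim_avg (G : sgraph) : (0 < #|G|)%N ->
  gdim G = (\sum_(x : G) gdim_at x) / #|G|%:R.
Proof.
move=> G0; rewrite gdimE -[_ == 0%N]negbK -lt0n G0 /= /gdim_at big_split /=.
rewrite sumr_const mulrDl divff // pnatr_eq0 -lt0n //.
Qed.

(** A complete subgraph is identified with its vertex set. *)
Definition is_simplex (G : sgraph) (x : {set G}) : bool :=
  (x != set0) && [forall u in x, forall v in x, (u != v) ==> sedge u v].

Definition simplex (G : sgraph) : finType := {x : {set G} | is_simplex x}.

Section Product.
Variables G H : sgraph.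

Definition gprod_rel : rel (simplex G * simplex H)%type := fun p q =>
  (p != q) &&
  ((val p.1 \subset val q.1) && (val p.2 \subset val q.2)
   || (val q.1 \subset val p.1) && (val q.2 \subset val p.2)).

Fact gprod_sym : symmetric gprod_rel.
Proof. by move=> p q; rewrite /gprod_rel eq_sym orbC. Qed.

Fact gprod_irr : irreflexive gprod_rel.
Proof. by move=> p; rewrite /gprod_rel eqxx. Qed.

Definition gprod : sgraph := SGraph gprod_sym gprod_irr.
End Product.

Fact K1_sym : symmetric (fun _ _ : unit => false). Proof. by []. Qed.
Fact K1_irr : irreflexive (fun _ _ : unit => false). Proof. by []. Qed.
Definition K1 : sgraph := SGraph K1_sym K1_irr.

Fact K1_simplex_subproof : @is_simplex K1 setT.
Proof.
apply/andP; split; first by apply/set0Pn; exists tt; rewrite inE.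
by apply/forall_inP => -[] _; apply/forall_inP => -[] _; rewrite eqxx.
Qed.

Definition K1_simplex : simplex K1 := exist _ setT K1_simplex_subproof.

(** [refine1 G] is $G_1 = G \times K_1$; [vtx1] identifies the simplices of [G] with its
    vertices (see [vtx1_bij] and [vtx1_edge]). *)
Definition refine1 (G : sgraph) : sgraph := gprod G K1.

Definition vtx1 (G : sgraph) (x : simplex G) : refine1 G := (x, K1_simplex).

Lemma K1_simplexE (s : simplex K1) : s = K1_simplex.
Proof.
apply/val_inj/setP => -[]; rewrite /= inE.
by case/andP: (valP s) => /set0Pn[[] ->].
Qed.

Lemma vtx1_bij (G : sgraph) : bijective (@vtx1 G).
Proof. by exists fst => // -[x s]; rewrite (K1_simplexE s). Qed.

Lemma vtx1_edge (G : sgraph) (x y : simplex G) :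
  sedge (vtx1 x) (vtx1 y) =
  (val x \proper val y) || (val y \proper val x).
Proof.
rewrite /= /gprod_rel /= subxx !andbT xpair_eqE eqxx andbT.
rewrite -val_eqE eqEsubset !properE /=.
by case: (sval x \subset _); case: (sval y \subset _).
Qed.

(* Main.v *)
(** Write D = 1 + dim.  D is additive on joins, and the neighbours of p in the
    comparability graph of a poset are the join of the strict down-set and the
    strict up-set of p.  In a poset with a rank function r, an open interval
    ]x, y[ has D = r y - r x - 1; hence D(> x) is the average of
    r y - r x + D(> y) over y > x, equivalently over y >= x.  The up-set of a pair
    in a product poset is the product of the up-sets, so by induction on its size
    this average splits and D(> (x, y)) = D(> x) + D(> y).  Down-sets follow by
    reversing the order. *)

From HB Require Import structures.
Require Import Defs.
From mathcomp Require Import all_boot all_order all_algebra.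
From mathcomp Require Import ring.

Set Implicit Arguments.
Unset Strict Implicit.
Unset Printing Implicit Defensive.

Import Num.Theory GRing.Theory.
Local Open Scope ring_scope.

(** * Dimension of vertex subsets and its invariance under embeddings *)

Definition nbhd (G : sgraph) (x : G) : {set G} := [set y | sedge x y].

(** Shifted by 1, so that the empty set has dimension [0] and joins are additive. *)
Definition setdim (G : sgraph) (A : {set G}) : rat := 1 + gdim (induced A).

Lemma sum_imset_setT (G H : sgraph) (f : H -> G) (F : G -> rat) :
  injective f -> \sum_(a in f @: [set: H]) F a = \sum_(x : H) F (f x).
Proof.
move=> fI; rewrite big_imset /=; last by move=> ? ? _ _; apply: fI.
by apply: eq_bigl => x; rewrite inE.
Qed.

(** Lets iterated spheres, which live on nested subtypes, be written as plain vertex subsets of one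
    ambient graph. *)
Lemma imset_comp_sphere (G H : sgraph) (f : H -> G) (x : H) :
    {mono f : u v / sedge u v} ->
  (f \o val) @: [set: sphere x] = f @: [set: H] :&: nbhd (f x).
Proof.
move=> fE; apply/setP => a; rewrite !inE; apply/imsetP/andP => [[u _ ->] | []].
  by split; [exact: imset_f | rewrite fE; have := valP u; rewrite inE].
case/imsetP=> y _ ->; rewrite fE => xy.
have yP : y \in [set z | sedge x z] by rewrite inE.
by exists (exist _ y yP).
Qed.

Lemma imset_val_induced (G : sgraph) (A : {set G}) :
  val @: [set: induced A] = A.
Proof.
apply/setP => a; apply/imsetP/idP => [[u _ ->] | aA]; first exact: valP.
by exists (exist _ a aA).
Qed.

Lemma sum_induced (G : sgraph) (A : {set G}) (F : G -> rat) :
  \sum_(a in A) F a = \sum_(x : induced A) F (val x).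
Proof.
rewrite -{1}(imset_val_induced A) (@sum_imset_setT _ (induced A)) //.
exact: val_inj.
Qed.

Lemma imset_sphere_induced (G : sgraph) (A : {set G}) (x : induced A) :
  (val \o val) @: [set: sphere x] = A :&: nbhd (val x).
Proof.
by rewrite (@imset_comp_sphere G (induced A) val) // imset_val_induced.
Qed.

(** By induction on size: the sphere at [x] and the sphere at its image both embed in [G] with the
    same image, so each is compared with one induced subgraph of [G]. *)
Lemma gdim_embed (G H : sgraph) (f : H -> G) :
    injective f -> {mono f : u v / sedge u v} ->
  gdim H = gdim (induced (f @: [set: H])).
Proof.
have [n] := ubnP #|H|; elim: n H f => // n IHn H f ltn fI fE.
set A := f @: _.
have cA : #|induced A| = #|H| by rewrite card_sig card_imset // cardsT.
rewrite !gdimE cA; case: eqP => // _; congr (_ + _ / _).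
transitivity (\sum_(a in A) gdim (induced (A :&: nbhd a))).
  rewrite sum_imset_setT //; apply: eq_bigr => x _.
  rewrite -(imset_comp_sphere x fE); apply: IHn.
  - exact: leq_trans (card_sphere x) _.
  - exact: inj_comp fI val_inj.
  - by move=> u v /=; rewrite fE.
rewrite sum_induced; apply: eq_bigr => x _.
rewrite -imset_sphere_induced.
apply/esym/IHn => //; first by rewrite (leq_trans (card_sphere x)) // cA.
exact: inj_comp val_inj val_inj.
Qed.

Lemma gdim_at_embed (G H : sgraph) (f : H -> G) (x : H) :
    bijective f -> {mono f : u v / sedge u v} ->
  gdim_at x = setdim (nbhd (f x)).
Proof.
move=> fB fE; have fI := bij_inj fB.
rewrite /gdim_at /setdim (@gdim_embed G (sphere x) (f \o val)).
- rewrite imset_comp_sphere //; congr (1 + gdim (induced _)).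
  rewrite -[RHS]setTI; congr (_ :&: _); apply/setP => a; rewrite inE.
  by have [g _ gK] := fB; rewrite -[a]gK imset_f.
- exact: inj_comp fI val_inj.
- by move=> u v /=; rewrite fE.
Qed.

(** * Recursion for the shifted dimension and additivity on joins *)

Section SetDimension.
Variable G : sgraph.
Implicit Types A B : {set G}.

Lemma setdim0 : setdim (set0 : {set G}) = 0.
Proof.
by rewrite /setdim gdimE card_sig eq_card0 ?addrN // => x; rewrite !inE.
Qed.

(** The defining recursion with its denominator cleared; in this form it covers the empty set as
    well. *)
Lemma setdimE A :
  #|A|%:R * setdim A = #|A|%:R + \sum_(x in A) setdim (A :&: nbhd x).
Proof.
have [->|A0] := eqVneq A set0; first by rewrite cards0 big_set0 mul0r addr0.
have cA : #|induced A| = #|A| by rewrite card_sig.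
rewrite /setdim gdimE cA cards_eq0 (negPf A0).
have -> : \sum_(x : induced A) gdim (sphere x)
        = \sum_(x in A) gdim (induced (A :&: nbhd x)).
  rewrite sum_induced; apply: eq_bigr => x _.
  rewrite -imset_sphere_induced.
  by apply: gdim_embed => //; exact: inj_comp val_inj val_inj.
rewrite big_split /= sumr_const.
have cn0 : #|A|%:R != 0 :> rat by rewrite pnatr_eq0 cards_eq0.
by field.
Qed.

Lemma setdim_avg A c : (0 < #|A|)%N ->
  {in A, forall x, setdim (A :&: nbhd x) = c} -> setdim A = 1 + c.
Proof.
move=> A0 Ac; have cn0 : #|A|%:R != 0 :> rat by rewrite pnatr_eq0 -lt0n.
apply: (mulfI cn0); rewrite setdimE (eq_bigr _ Ac) sumr_const.
by rewrite mulrDr mulr1 mulr_natl.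
Qed.

(** Inside a join, the neighbours of [x] in [A] are the join of [A :&: nbhd x] with all of [B]. This
    is a smaller join, so induction applies to every term of the recursion. *)
Lemma setdim_join A B : {in A & B, forall x y, sedge x y} ->
  setdim (A :|: B) = setdim A + setdim B.
Proof.
have [n] := ubnP (#|A| + #|B|)%N; elim: n A B => // n IHn A B ltn AB.
have [->|A0] := eqVneq A set0; first by rewrite set0U setdim0 add0r.
have [->|B0] := eqVneq B set0; first by rewrite setU0 setdim0 addr0.
have dAB : [disjoint A & B].
  rewrite disjoint_subset; apply/subsetP => x xA.
  rewrite !inE; apply/negP => xB.
  by have := AB x x xA xB; rewrite sedge_irr.
(* Stated for arbitrary [C] and [D] because it serves once for each side of the join. *)
have sum_nbhd (C D : {set G}) : (#|C| + #|D| < n.+1)%N ->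
    {in C & D, forall x y, sedge x y} ->
    \sum_(x in C) setdim ((C :|: D) :&: nbhd x)
    = #|C|%:R * (setdim C + setdim D - 1).
  move=> ltCD CD.
  transitivity (\sum_(x in C) (setdim (C :&: nbhd x) + setdim D)).
    apply: eq_bigr => x xC.
    have -> : (C :|: D) :&: nbhd x = (C :&: nbhd x) :|: D.
      rewrite setIUl; congr (_ :|: _); apply/setIidPl/subsetP => y yD.
      by rewrite inE CD.
    apply: IHn => [|u v /setIP[uC _]]; last exact: CD.
    rewrite -ltnS (leq_trans _ ltCD) // !ltnS ltn_add2r.
    apply/proper_card/properP; split; first exact: subsetIl.
    by exists x => //; rewrite !inE sedge_irr andbF.
  have /esym/(canRL (addKr _)) sumC := setdimE C.
  by rewrite big_split sumC sumr_const -[_ *+ #|C|]mulr_natl /=; ring.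
have cn0 : #|A :|: B|%:R != 0 :> rat.
  by rewrite pnatr_eq0 cards_eq0 setU_eq0 negb_and A0.
apply: (mulfI cn0); rewrite setdimE.
rewrite (eq_bigl [predU A & B]) => [|x]; last by rewrite !inE.
rewrite bigU //= sum_nbhd // setUC sum_nbhd; last 2 first.
- by rewrite addnC.
- by move=> x y xB yA; rewrite sedge_sym AB.
rewrite cardsU setIC (disjoint_setI0 dAB) cards0 subn0 natrD.
by ring.
Qed.

End SetDimension.

(** * Comparability graphs of ranked posets *)

Section Comparability.
Context {d : Order.disp_t} (T : finPOrderType d).
Import Order.Theory.
Local Open Scope order_scope.

Definition comparability : rel T := fun x y => (x < y) || (y < x).

Fact comparability_sym : symmetric comparability.
Proof. by move=> x y; rewrite /comparability orbC. Qed.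

Fact comparability_irr : irreflexive comparability.
Proof. by move=> x; rewrite /comparability ltxx. Qed.

Definition compgraph := SGraph comparability_sym comparability_irr.

Definition above (x : T) : {set compgraph} := [set y : T | x < y].
Definition below (x : T) : {set compgraph} := [set y : T | y < x].

Lemma setdim_nbhd (x : T) :
  setdim (nbhd (x : compgraph)) = setdim (below x) + setdim (above x).
Proof.
rewrite -setdim_join => [|y z].
  by congr setdim; apply/setP => y; rewrite !inE orbC.
by rewrite !inE /= /comparability => yx xz; rewrite (lt_trans yx xz).
Qed.

(** Rational values let the same notion serve the dual order, with rank [- r]. *)
Definition is_rank (r : T -> rat) :=
  forall x y, x < y -> (forall z, ~~ (x < z < y)) -> r y = (r x + 1)%R.

Variable r : T -> rat.
Hypothesis rP : is_rank r.

(** A point [z] of the interval has as neighbours the join of []x, z[] and []z, y[]. By induction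
    their contributions add up to [r y - r x - 2], independently of [z]. *)
Lemma setdim_interval (x y : T) : x < y ->
  setdim (above x :&: below y) = (r y - r x - 1)%R.
Proof.
have [n] := ubnP #|above x :&: below y|; elim: n x y => // n IHn x y ltn xy.
have [I0|] := posnP #|above x :&: below y|.
  (* An empty interval means that [y] covers [x], so the ranks differ by 1. *)
  rewrite (cards0_eq I0) setdim0 (rP xy); first by ring.
  by move=> z; move/cards0_eq/setP/(_ z): I0; rewrite !inE => ->.
move=> I1; rewrite (@setdim_avg _ _ (r y - r x - 2)%R I1); first by ring.
move=> z; rewrite !inE => /andP[xz zy].
have -> : above x :&: below y :&: nbhd (z : compgraph)
        = (above x :&: below z) :|: (above z :&: below y).
  apply/setP => t; rewrite !inE /= /comparability.
  case tz: (t < z); rewrite ?andbT ?orbT ?andbF /=.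
    by rewrite (lt_trans tz zy) (lt_gtF tz) !andbT orbF.
  rewrite orbF; case zt: (z < t); last by rewrite andbF.
  by rewrite (lt_trans xz zt) andbT.
have zI : z \in above x :&: below y by rewrite !inE xz.
have sub1 : (#|above x :&: below z| < n)%N.
  rewrite -ltnS (leq_trans _ ltn) // ltnS; apply/proper_card/properP; split.
    by apply/subsetP => t; rewrite !inE => /andP[-> /lt_trans->].
  by exists z => //; rewrite !inE ltxx andbF.
have sub2 : (#|above z :&: below y| < n)%N.
  rewrite -ltnS (leq_trans _ ltn) // ltnS; apply/proper_card/properP; split.
    by apply/subsetP => t; rewrite !inE => /andP[/(lt_trans xz)-> ->].
  by exists z => //; rewrite !inE ltxx.
rewrite setdim_join => [|u v]; first by rewrite !IHn //; ring.
rewrite !inE /= /comparability => /andP[_ uz] /andP[zv _].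
by rewrite (lt_trans uz zv).
Qed.

(** The neighbours of [y] above [x] are the join of []x, y[] and [above y]; the -1 from the interval
    cancels the 1 of the recursion. *)
Lemma setdim_aboveE (x : T) :
  (#|above x|%:R * setdim (above x) =
   \sum_(y in above x) (r y - r x + setdim (above y)))%R.
Proof.
rewrite setdimE -[X in (X + _)%R]sumr_const -big_split /=.
apply: eq_bigr => y; rewrite inE => xy.
have -> : above x :&: nbhd (y : compgraph) = (above x :&: below y) :|: above y.
  apply/setP => t; rewrite !inE /= /comparability andb_orr orbC; congr (_ || _).
  by apply: andb_idl; apply: lt_trans.
rewrite setdim_join => [|u v]; first by rewrite setdim_interval //; ring.
rewrite !inE /= /comparability => /andP[_ uy] yv.
by rewrite (lt_trans uy yv).
Qed.

(** Including [y = x], whose term is the average of the others, makes the index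
    set of a product poset a full product. *)
Lemma setdim_above_sum (x : T) :
  (\sum_(y | (x <= y)%O) (r y - r x + setdim (above y)) =
   #|[pred y | (x <= y)%O]|%:R * setdim (above x))%R.
Proof.
rewrite (bigD1 x) //= subrr add0r (cardD1 x) inE lexx natrD mulrDl mul1r.
congr (_ + _)%R; rewrite (eq_card (_ : _ =i above x)) => [|y]; last first.
  by rewrite !inE lt_def.
rewrite setdim_aboveE; apply: eq_bigl => y; by rewrite inE lt_def andbC.
Qed.

End Comparability.

(** * Order reversal *)

Lemma is_rank_dual d (P : finPOrderType d) (t : P -> rat) :
  is_rank t -> is_rank (fun x : P^d => - t x).
Proof.
move=> tP x y /= yx noI; rewrite [t x](tP y x yx); first by ring.
by move=> z; have := noI z; rewrite andbC.
Qed.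

(** Reversing the order leaves comparability unchanged, so the inclusion into the dual poset is an
    embedding with image [above x]. *)
Lemma setdim_below_dual d (P : finPOrderType d) (x : P) :
  setdim (below x) = setdim (above (x : P^d)).
Proof.
rewrite /setdim; congr (1 + _).
rewrite (@gdim_embed (compgraph P^d) (induced (below x)) val).
- by rewrite (@imset_val_induced (compgraph P)).
- exact: val_inj.
- by move=> u v; rewrite /= /induced_rel /= /comparability orbC.
Qed.

(** * Up-sets and neighbourhoods in product posets *)

Section Product.
Context {d1 d2 : Order.disp_t} (S : finPOrderType d1) (T : finPOrderType d2).
Import Order.Theory.
Local Open Scope order_scope.
Variables (r : S -> rat) (s : T -> rat).
Hypotheses (rP : is_rank r) (sP : is_rank s).

(** A covering pair differs in exactly one coordinate: if both changed, [(x, y')] would lie strictly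
    between. *)
Lemma is_rank_prod : is_rank (fun p : S *p T => r p.1 + s p.2)%R.
Proof.
move=> [x y] [x' y'] lt_pq noI /=.
have /andP[/= xx' yy'] : (x <= x') && (y <= y') := ltW lt_pq.
have [ex|nx] := eqVneq x x'; [subst x'|].
  have [ey|ny] := eqVneq y y'; first by move: lt_pq; rewrite ey ltxx.
  rewrite (sP (x := y) (y := y')) ?addrA // ?lt_neqAle ?ny // => z.
  apply: contra (noI (x, z)); rewrite !ltEprod /= lexx !xpair_eqE eqxx /=.
  by rewrite !lt_neqAle.
have [ey|ny] := eqVneq y y'; [subst y'|].
  rewrite (rP (x := x) (y := x')) 1?addrAC // ?lt_neqAle ?nx // => z.
  apply: contra (noI (z, y)); rewrite !ltEprod /= lexx !xpair_eqE eqxx !andbT.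
  by rewrite !lt_neqAle.
have := noI (x, y'); rewrite !ltEprod /= !xpair_eqE !lexx !eqxx /= xx' yy'.
by rewrite (negPf nx) ny.
Qed.

Lemma setdim_above_prod (x : S) (y : T) :
  setdim (above ((x, y) : S *p T)) = (setdim (above x) + setdim (above y))%R.
Proof.
have [n] := ubnP #|above ((x, y) : S *p T)|; elim: n x y => // n IHn x y ltn.
set p : S *p T := (x, y).
(* The averaging argument divides by the size of the strict up-set, so a maximal [p] is treated
   apart. *)
have [I0|Ipos] := posnP #|above p|.
  rewrite (cards0_eq I0) setdim0.
  have -> : above x = set0.
    apply/setP => z; move/cards0_eq/setP/(_ (z, y)): I0.
    by rewrite !inE ltEprod /= lexx xpair_eqE eqxx !andbT lt_neqAle.
  have -> : above y = set0.
    apply/setP => z; move/cards0_eq/setP/(_ (x, z)): I0.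
    by rewrite !inE ltEprod /= lexx xpair_eqE eqxx lt_neqAle.
  by rewrite !setdim0 addr0.
have cn0 : (#|above p|%:R != 0 :> rat)%R by rewrite pnatr_eq0 -lt0n.
pose g1 x' := (r x' - r x + setdim (above x'))%R.
pose g2 y' := (s y' - s y + setdim (above y'))%R.
apply: (mulfI cn0); rewrite (setdim_aboveE is_rank_prod).
transitivity (\sum_(q in above p) (g1 q.1 + g2 q.2))%R.
  apply: eq_bigr => -[x' y'] q_p.
  rewrite IHn; first by rewrite /g1 /g2 /=; ring.
  rewrite -ltnS (leq_trans _ ltn) // ltnS; apply/proper_card/properP; split.
    move: q_p; rewrite inE => q_p.
    by apply/subsetP => t; rewrite !inE; apply: lt_trans.
  by exists (x', y') => //; rewrite inE ltxx.
(* The closed up-set of [p] is [above p] with [p] added, and it is the product of the closed up-sets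
   of [x] and [y]. *)
have cE : (#|above p|%:R + 1 = #|[pred z | (x <= z)%O]|%:R
          * #|[pred z | (y <= z)%O]|%:R :> rat)%R.
  rewrite -natrM -cardX natr1.
  rewrite -[RHS](_ : #|[pred q : S *p T | (p <= q)%O]|%:R = _).
    rewrite [in RHS](cardD1 p) inE lexx add1n; congr (_.+1%:R).
    by apply: eq_card => q; rewrite !inE lt_def.
  by congr (_%:R); apply: eq_card => -[u v].
(* Adding the term of [p] itself extends the sum to this full product, where it splits by
   coordinates. *)
apply: (addIr (g1 x + g2 y)%R).
have -> : (\sum_(q in above p) (g1 q.1 + g2 q.2) + (g1 x + g2 y) =
           \sum_(q : S * T | (x <= q.1)%O && (y <= q.2)%O) (g1 q.1 + g2 q.2))%R.
  rewrite [RHS](bigD1 (x, y)) ?lexx //= addrC; congr (_ + _)%R.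
  by apply: eq_bigl => q; rewrite inE lt_def andbC.
rewrite -(pair_big_dep (fun u => x <= u)%O (fun _ v => y <= v)%O
            (fun u v => g1 u + g2 v)%R) /=.
have sum1 : (\sum_(u | (x <= u)%O) g1 u = _)%R := setdim_above_sum rP x.
have sum2 : (\sum_(v | (y <= v)%O) g2 v = _)%R := setdim_above_sum sP y.
under eq_bigr do rewrite big_split sumr_const sum2 /=.
rewrite big_split sumr_const sumrMnl /= sum1.
rewrite -[LHS]/(#|[pred z | (x <= z)%O]|%:R * setdim (above x)
                  *+ #|[pred z | (y <= z)%O]|
                + #|[pred z | (y <= z)%O]|%:R * setdim (above y)
                  *+ #|[pred z | (x <= z)%O]|)%R.
rewrite -[X in (X + _)%R]mulr_natl -[X in (_ + X = _)%R]mulr_natl.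
have -> : (g1 x + g2 y = setdim (above x) + setdim (above y))%R.
  by rewrite /g1 /g2 !subrr !add0r.
transitivity ((#|above p|%:R + 1) * (setdim (above x) + setdim (above y)))%R;
  last by rewrite mulrDl mul1r.
rewrite cE.
by ring.
Qed.

End Product.

Lemma setdim_nbhd_prod (d1 d2 : Order.disp_t)
    (S : finPOrderType d1) (T : finPOrderType d2) (r : S -> rat) (s : T -> rat)
    (rP : is_rank r) (sP : is_rank s) (x : S) (y : T) :
  setdim (nbhd ((x, y) : compgraph (S *p T)))
  = setdim (nbhd (x : compgraph S)) + setdim (nbhd (y : compgraph T)).
Proof.
rewrite !setdim_nbhd (setdim_above_prod rP sP) !setdim_below_dual.
(* The dual of the product order is, up to conversion, the product of the dual orders. *)
rewrite [X in X + _ = _](setdim_above_prod (is_rank_dual rP) (is_rank_dual sP)).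
by rewrite addrACA.
Qed.

(** * The face poset, ranked by cardinality *)

Section SimplexOrder.
Variable G : sgraph.
Import Order.Theory.

(** An alias of [simplex G] to carry the inclusion order. *)
Definition face_poset : Type := simplex G.

HB.instance Definition _ := Finite.on face_poset.

Definition face (x y : face_poset) : bool := sval x \subset sval y.

Fact face_refl : reflexive face. Proof. by move=> x; apply: subxx. Qed.

Fact face_anti : antisymmetric face.
Proof. by move=> x y; rewrite /face -eqEsubset => /eqP/val_inj. Qed.

Fact face_trans : transitive face.
Proof. by move=> y x z; apply: subset_trans. Qed.

Fact face_display : Order.disp_t. Proof. by []. Qed.

HB.instance Definition _ :=
  Order.Le_isPOrder.Build face_display face_poset
    face_refl face_anti face_trans.

Lemma lt_face (x y : face_poset) : (x < y)%O = (sval x \proper sval y).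
Proof. by rewrite lt_neqAle -val_eqE /= properEneq. Qed.

Lemma sub_simplex (x : simplex G) (y : {set G}) :
  y != set0 -> y \subset sval x -> is_simplex y.
Proof.
move=> y0 /subsetP yx; apply/andP; split => //.
have /andP[_ /forall_inP xP] := valP x.
by apply/forall_inP => u /yx/xP/forall_inP xu; apply/forall_inP => v /yx/xu.
Qed.

(** Deleting from [y] a vertex [u] outside [x] leaves a simplex that still contains [x]; as nothing
    lies strictly between, it equals [x]. *)
Lemma face_rank : is_rank (fun x : face_poset => #|sval x|%:R).
Proof.
move=> x y; rewrite lt_face => xy noI.
have [xsy [u yu xu]] := properP xy.
have x_sub : sval x \subset sval y :\ u by rewrite subsetD1 xsy.
have z0 : sval y :\ u != set0.
  have /andP[x0 _] := valP x.
  by apply: contraNneq x0 => z0; rewrite -subset0 -z0.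
have zP := sub_simplex z0 (subD1set _ _).
have := noI (exist (@is_simplex G) _ zP).
rewrite !lt_face /= [_ \proper sval y]properD1 // andbT.
rewrite properEneq x_sub andbT negbK => /eqP ->.
by rewrite (cardsD1 u (sval y)) yu natrD addrC.
Qed.

End SimplexOrder.

(** * Dimension of product graphs *)

Lemma gdim_at_gprod (G H : sgraph) (x : simplex G) (y : simplex H) :
  gdim_at ((x, y) : gprod G H)
  = setdim (nbhd (x : compgraph (face_poset G)))
    + setdim (nbhd (y : compgraph (face_poset H))).
Proof.
rewrite -(setdim_nbhd_prod (@face_rank G) (@face_rank H)).
(* Adjacency in the product graph is comparability in the product of the face posets, so the
   identity is an isomorphism. *)
apply: (@gdim_at_embed
  (compgraph (face_poset G *p face_poset H)) (gprod G H) id).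
  by exists id.
move=> p q; rewrite /= /comparability !Order.ProdOrder.ltEprod /gprod_rel.
by rewrite [q == p]eq_sym -andb_orr.
Qed.

(** The face poset of [K1] is a single point; hence the [K1] factor adds nothing to the dimension at
    a vertex of [refine1 G]. *)
Lemma setdim_nbhd_K1 (s : simplex K1) :
  setdim (nbhd (s : compgraph (face_poset K1))) = 0.
Proof.
rewrite -[RHS](setdim0 (compgraph (face_poset K1))); congr setdim.
by apply/setP => t; rewrite !inE (K1_simplexE s) (K1_simplexE t) sedge_irr.
Qed.

Lemma card_simplex_gt0 (G : sgraph) : (0 < #|G|)%N -> (0 < #|simplex G|)%N.
Proof.
case/card_gt0P => u _; have uP : @is_simplex G [set u].
  apply/andP; split; first by apply/set0Pn; exists u; rewrite inE.
  apply/forall_inP => v /set1P ->; apply/forall_inP => w /set1P ->.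
  by rewrite eqxx.
by apply/card_gt0P; exists (exist (@is_simplex G) _ uP).
Qed.

Lemma gdim_refine1 (G : sgraph) : (0 < #|G|)%N ->
  gdim (refine1 G) = (\sum_(x : simplex G) gdim_at (vtx1 x)) / #|simplex G|%:R.
Proof.
move=> /card_simplex_gt0 G0.
have cE : #|refine1 G| = #|simplex G| := esym (bij_eq_card (@vtx1_bij G)).
rewrite gdim_avg cE //; congr (_ / _).
by rewrite (reindex (@vtx1 G)) //; apply: onW_bij; apply: vtx1_bij.
Qed.

Theorem theorem14 (G H : sgraph) (hG : (0 < #|G|)%N) (hH : (0 < #|H|)%N) :
  gdim (gprod G H) = gdim (refine1 G) + gdim (refine1 H) /\
  (forall (x : simplex G) (y : simplex H),
     gdim_at ((x, y) : gprod G H) = gdim_at (vtx1 x) + gdim_at (vtx1 y)).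
Proof.
have add_at (x : simplex G) (y : simplex H) :
    gdim_at ((x, y) : gprod G H) = gdim_at (vtx1 x) + gdim_at (vtx1 y).
  (* The product formula is used three times: for [G] with [H], and for each of them with [K1]. *)
  by rewrite !gdim_at_gprod !setdim_nbhd_K1 !addr0.
split=> //; rewrite !gdim_refine1 //.
have sG := card_simplex_gt0 hG; have sH := card_simplex_gt0 hH.
have cE : #|gprod G H| = (#|simplex G| * #|simplex H|)%N by rewrite card_prod.
rewrite gdim_avg ?cE ?muln_gt0 ?sG // natrM.
(* Averaging a sum of one-variable functions over all pairs gives the sum of their averages. *)
have -> : \sum_(p : gprod G H) gdim_at p
        = \sum_(x : simplex G) \sum_(y : simplex H)
            (gdim_at (vtx1 x) + gdim_at (vtx1 y)).
  rewrite (pair_big xpredT xpredT) /=.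
  by apply: eq_bigr => -[x y] _; apply: add_at.
under eq_bigr do rewrite big_split sumr_const /=.
rewrite big_split sumr_const sumrMnl /=.
rewrite -[X in X + _]mulr_natl -[X in _ + X]mulr_natl.
have nG : #|simplex G|%:R != 0 :> rat by rewrite pnatr_eq0 -lt0n.
have nH : #|simplex H|%:R != 0 :> rat by rewrite pnatr_eq0 -lt0n.
by field; apply/andP; split; [exact: nH | exact: nG].
Qed.
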